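(* Let $A$ be a finite alphabet and let $\sigma\colon A^*\to A^*$ be a monoid morphism (possibly with $\sigma(a)=\varepsilon$ for some letters $a$). Then $\sigma$ is recognizable on $X(\sigma)$ for aperiodic points.
   Context: $A^*$ is the free monoid on $A$ and $\varepsilon$ the empty word. The shift transformation $S\colon A^{\mathbb Z}\to A^{\mathbb Z}$ is defined by $S(x)_n=x_{n+1}$. A point $y\in A^{\mathbb Z}$ is periodic if $S^n(y)=y$ for some $n\ge 1$, and aperiodic otherwise. A morphism $\sigma$ is extended to two-sided infinite sequences by concatenation: for $x=(x_n)_{n\in\mathbb Z}$, $\sigma(x)=\cdots\sigma(x_{-2})\sigma(x_{-1})\cdot\sigma(x_0)\sigma(x_1)\cdots$, where position $0$ is the first position to the right of the dot (if $\sigma$ is erasing, the left or right part may be finite). The language $\mathcal L(\sigma)$ is the set of factors (contiguous subwords) of the words $\sigma^n(a)$ with $n\ge 0$ and $a\in A$. The shift $X(\sigma)$ is the set of $x\in A^{\mathbb Z}$ all of whose finite factors belong to $\mathcal L(\sigma)$. A $\sigma$-representation of $y\in A^{\mathbb Z}$ is a pair $(x,k)$ with $x\in A^{\mathbb Z}$, $k\in\mathbb Z$, such that $\sigma(x)$ is two-sided infinite and $y=S^k(\sigma(x))$. It is centered if $0\le k<|\sigma(x_0)|$. For a shift space $X\subseteq A^{\mathbb Z}$, $\sigma$ is recognizable on $X$ for aperiodic points if every aperiodic point $y\in A^{\mathbb Z}$ has at most one centered $\sigma$-representation $(x,k)$ with $x\in X$. *)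

(* Defs.v *)
From mathcomp Require Import all_boot all_order all_algebra.

Set Implicit Arguments.
Unset Strict Implicit.
Unset Printing Implicit Defensive.

Import Order.TTheory GRing.Theory Num.Theory.
Local Open Scope ring_scope.

Definition word_morphism (A : Type) (sigma : seq A -> seq A) : Prop :=
  sigma [::] = [::] /\ {morph sigma : u v / u ++ v}.

Definition shift (A : Type) (x : int -> A) : int -> A := fun n => x (n + 1).

(* The power [S^k] of the shift for an exponent [k] of arbitrary sign; see
   [shiftz_nat] and [shiftzD]. *)
Definition shiftz (A : Type) (k : int) (x : int -> A) : int -> A :=
  fun n => x (n + k).

Definition periodic (A : Type) (y : int -> A) : Prop :=
  exists2 n : nat, (1 <= n)%N & iter n (@shift A) y =1 y.

Definition aperiodic (A : Type) (y : int -> A) : Prop := ~ periodic y.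

(* The factor [x_i x_(i+1) ... x_(i+n-1)] of length [n]. *)
Definition factor (A : Type) (x : int -> A) (i : int) (n : nat) : seq A :=
  mkseq (fun j : nat => x (i + j%:Z)) n.

Definition in_language (A : eqType) (sigma : seq A -> seq A) (w : seq A) :
    Prop :=
  exists (n : nat) (a : A), infix w (iter n sigma [:: a]).

Definition shift_of (A : eqType) (sigma : seq A -> seq A) (x : int -> A) :
    Prop :=
  forall (i : int) (n : nat), in_language sigma (factor x i n).

(* Image under [sigma] of [x_0 ... x_(n-1)], resp. of [x_(-n) ... x_(-1)]. *)
Definition image_right (A : Type) (sigma : seq A -> seq A) (x : int -> A)
    (n : nat) : seq A :=
  sigma (factor x 0 n).

Definition image_left (A : Type) (sigma : seq A -> seq A) (x : int -> A)
    (n : nat) : seq A :=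
  sigma (factor x (- n%:Z) n).

(* [sigma] may erase letters, so either half of [sigma(x)] may be finite. *)
Definition two_sided_infinite (A : Type) (sigma : seq A -> seq A)
    (x : int -> A) : Prop :=
  (forall N : nat, exists n : nat, (N <= size (image_right sigma x n))%N) /\
  (forall N : nat, exists n : nat, (N <= size (image_left sigma x n))%N).

(* [is_image sigma x z] says that [sigma(x)] is two-sided infinite and equal
   to [z]. The extension of [sigma] to sequences is partial, hence the
   relational form; [is_image_uniq] and [is_image_ex] show that it is the graph
   of a function with domain [two_sided_infinite sigma]. *)
Definition is_image (A : Type) (sigma : seq A -> seq A) (x z : int -> A) :
    Prop :=
  [/\ two_sided_infinite sigma x,
      forall n : nat, let w := image_right sigma x n in
        factor z 0 (size w) = w
    & forall n : nat, let w := image_left sigma x n in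
        factor z (- (size w)%:Z) (size w) = w].

Definition representation (A : Type) (sigma : seq A -> seq A) (y : int -> A)
    (x : int -> A) (k : int) : Prop :=
  exists2 z : int -> A, is_image sigma x z & y =1 shiftz k z.

Definition centered (A : Type) (sigma : seq A -> seq A) (x : int -> A)
    (k : int) : Prop :=
  0 <= k < (size (sigma [:: x 0]))%:Z.

(* Points of [A^Z] are compared pointwise, so that no extensionality axiom is
   involved. *)
Definition recognizable_aperiodic (A : Type) (sigma : seq A -> seq A)
    (X : (int -> A) -> Prop) : Prop :=
  forall y : int -> A, aperiodic y ->
  forall (x x' : int -> A) (k k' : int),
    X x -> representation sigma y x k -> centered sigma x k ->
    X x' -> representation sigma y x' k' -> centered sigma x' k' ->
    x =1 x' /\ k = k'.

Lemma shiftz_nat (A : Type) (n : nat) (x : int -> A) :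
  shiftz n%:Z x =1 iter n (@shift A) x.
Proof.
elim: n => [|n IHn] i; first by rewrite /shiftz addr0.
by rewrite iterS /shift -IHn /shiftz -addrA intS.
Qed.

Lemma shiftzD (A : Type) (k l : int) (x : int -> A) :
  shiftz k (shiftz l x) =1 shiftz (k + l) x.
Proof. by move=> i; rewrite /shiftz addrA. Qed.

Lemma is_image_uniq (A : Type) (sigma : seq A -> seq A) (x z z' : int -> A) :
  is_image sigma x z -> is_image sigma x z' -> z =1 z'.
Proof.
move=> [[infR infL] zR zL] [_ zR' zL'] [] i.
- have [n lt_i] := infR i.+1.
  have := etrans (zR n) (esym (zR' n)); move/(congr1 (nth (z 0) ^~ i)).
  by rewrite !nth_mkseq // !add0r.
- have [n lt_i] := infL i.+1.
  set w := image_left sigma x n in lt_i.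
  have := etrans (zL n) (esym (zL' n)); rewrite -/w /=.
  move/(congr1 (nth (z 0) ^~ (size w - i.+1)%N)).
  have lt_w : (size w - i.+1 < size w)%N by rewrite ltn_subrL (leq_trans _ lt_i).
  rewrite !nth_mkseq // -subzn //.
  by rewrite addrA addNr add0r NegzE.
Qed.

Lemma factorD (A : Type) (x : int -> A) (i : int) (m n : nat) :
  factor x i (m + n) = factor x i m ++ factor x (i + m%:Z) n.
Proof.
rewrite /factor /mkseq iotaD map_cat add0n; congr (_ ++ _).
rewrite -[X in iota X]addn0 iotaDl -map_comp.
by apply: eq_map => j /=; rewrite PoszD addrA.
Qed.

Lemma is_image_ex (A : Type) (sigma : seq A -> seq A) (x : int -> A) :
  word_morphism sigma -> two_sided_infinite sigma x ->
  exists z : int -> A, is_image sigma x z.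
Proof.
move=> [_ sigmaM] inf; have [infR infL] := inf.
pose wR i := image_right sigma x (ex_minn (infR i.+1)).
pose wL i := image_left sigma x (ex_minn (infL i.+1)).
have wRi i : (i < size (wR i))%N by rewrite /wR; case: ex_minnP.
have wLi i : (i < size (wL i))%N by rewrite /wL; case: ex_minnP.
have catR m n : (m <= n)%N ->
    exists u, image_right sigma x n = image_right sigma x m ++ u.
  move=> /subnKC <-; rewrite /image_right factorD sigmaM; by eexists.
have catL m n : (m <= n)%N ->
    exists u, image_left sigma x n = u ++ image_left sigma x m.
  move=> le_mn; rewrite /image_left -{2}(subnK le_mn) factorD sigmaM.
  exists (sigma (factor x (- n%:Z) (n - m))).
  by rewrite -subzn // addrA addNr add0r.
have nthR i n : (i < size (image_right sigma x n))%N ->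
    nth (x 0) (image_right sigma x n) i = nth (x 0) (wR i) i.
  move=> lt_i; have := wRi i; rewrite /wR; move: (ex_minn _) => m lt_im.
  by have [/catR[u ->]|/ltnW/catR[u ->]] := leqP m n; rewrite nth_cat ?lt_i ?lt_im.
have nthL i n : (i < size (image_left sigma x n))%N ->
    nth (x 0) (rev (image_left sigma x n)) i = nth (x 0) (rev (wL i)) i.
  move=> lt_i; have := wLi i; rewrite /wL; move: (ex_minn _) => m lt_im.
  by have [/catL[u ->]|/ltnW/catL[u ->]] := leqP m n;
     rewrite rev_cat nth_cat !size_rev ?lt_i ?lt_im.
exists (fun i => match i with
  | Posz i => nth (x 0) (wR i) i
  | Negz i => nth (x 0) (rev (wL i)) i end).
split=> // n w.
- apply: (@eq_from_nth _ (x 0)); rewrite size_mkseq // => i lt_i.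
  by rewrite nth_mkseq // add0r -(nthR i n).
- apply: (@eq_from_nth _ (x 0)); rewrite size_mkseq // => i lt_i.
  rewrite nth_mkseq //.
  have -> : - (size w)%:Z + i%:Z = Negz (size w - i.+1)%N.
    by rewrite NegzE subnSK // -subzn 1?ltnW // opprB addrC.
  have lt_w : (size w - i.+1 < size w)%N.
    by rewrite ltn_subrL (leq_trans _ lt_i).
  by rewrite -(nthL _ n) // nth_rev // subnSK // subKn // ltnW.
Qed.

(* Main.v *)
Require Import Defs.
From mathcomp Require Import all_boot all_order all_algebra.
From mathcomp Require Import zify.
From Stdlib Require Import Classical Relation_Operators IndefiniteDescription.

(** Why the theorem is true.

    Among all pairs of an exponent n and a finite list Y of words such that
    every sigma^n(a) is a product of words of Y, take one with Y as short as
    possible ([least_factorization]). Then the list X of the words sigma(v),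
    v in Y, is elementary: a list Z whose products include X has at least as
    many words as X, because the products of Z also include all the
    sigma^(n+1)(a). In particular X has no repetition and does not contain the
    empty word, so sigma is injective on Y and erases no word of Y. The erasing
    letters of sigma are thus hidden inside the blocks of Y.

    A point x of X(sigma) has all its factors inside words sigma^l(a) with l
    large, hence inside products of words of Y. By compactness x is itself a
    bi-infinite product of blocks of Y ([factors_parse]), and a
    sigma-representation of y by x cuts y into blocks of X ([image_parse]).

    The heart is that an aperiodic y has only one factorization over an
    elementary X ([parse_unique]). It rests on a graph form of the defect
    theorem ([defect]): join two words a, b of X when some long products a u
    and b v of words of X are comparable for the prefix order; then X consists
    of products of words of a list that has one word for each connected
    component. For elementary X this gives two facts.
    - Two blocks of X that start long comparable products are equal
      ([elementary_inj]): two factorizations that agree somewhere agree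
      everywhere to the right of it.
    - Suppose that at some position one factorization starts a new block while
      a nonempty word z remains before the next cut of the other. Then z
      determines the new block ([elementary_delay]): if a and b were both
      possible, adding z to X would join both of them to z, and the defect
      theorem would give a list shorter than X.
    So, as long as the factorizations disagree, the pair formed by the current
    block and offset in each of them evolves deterministically, in a finite
    set. If they disagree somewhere, they disagree everywhere to the left, so
    arbitrarily far to the left some pair occurs twice within a bounded
    distance; from the first of these two occurrences on, the sequence of pairs
    is periodic and no agreement ever takes place. Hence y is periodic.

    Finally, equal factorizations of y give equal blocks of Y, and the position
    of x_0 inside its block is determined by the cuts of y, since the
    representation is centered ([representation_unique]). *)

Set Implicit Arguments.
Unset Strict Implicit.
Unset Printing Implicit Defensive.

(** * Products of words and prefix comparability *)

Definition star (A : eqType) (Y : seq (seq A)) (w : seq A) : Prop :=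
  exists2 ws : seq (seq A), {subset ws <= Y} & w = flatten ws.

Lemma star1 (A : eqType) (Y : seq (seq A)) w : w \in Y -> star Y w.
Proof.
move=> Yw; exists [:: w]; last by rewrite /= cats0.
by move=> x; rewrite inE => /eqP->.
Qed.

Lemma star_cat (A : eqType) (Y : seq (seq A)) u v :
  star Y u -> star Y v -> star Y (u ++ v).
Proof.
move=> [us Yu ->] [vs Yv ->]; exists (us ++ vs); last by rewrite flatten_cat.
by move=> x; rewrite mem_cat => /orP[/Yu|/Yv].
Qed.

Lemma star_flatten (A : eqType) (Y : seq (seq A)) ws :
  (forall w, w \in ws -> star Y w) -> star Y (flatten ws).
Proof.
elim: ws => [|w ws IH] Yws /=; first by exists [::].
apply: star_cat; first by apply: Yws; rewrite mem_head.
by apply: IH => x xws; apply: Yws; rewrite inE xws orbT.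
Qed.

Definition prefix_comparable (A : eqType) (u v : seq A) : bool :=
  prefix u v || prefix v u.

Lemma prefix_comparableC (A : eqType) (u v : seq A) :
  prefix_comparable u v = prefix_comparable v u.
Proof. exact: orbC. Qed.

Lemma prefix_comparable_cat2l (A : eqType) (w u v : seq A) :
  prefix_comparable (w ++ u) (w ++ v) = prefix_comparable u v.
Proof. by elim: w => //= x w; rewrite /prefix_comparable /= eqxx. Qed.

Lemma prefix_comparable_catW (A : eqType) (u v u' v' : seq A) :
  prefix_comparable (u ++ u') (v ++ v') -> prefix_comparable u v.
Proof.
elim: u v => [|x u IH] [|y v] //=; rewrite /prefix_comparable /= => [].
by rewrite eq_sym; case: (y == x) => //= /IH.
Qed.

(** * The defect theorem for the graph of long comparable products *)

(** Finite form of the relation a X^omega meets b X^omega. The depth [N] makes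
    up for the use of finite products: each reduction below costs one block of
    [u] and [v] and removes at least one letter from [X], so that a depth equal
    to the total length of [X] suffices. *)
Definition edge (A : eqType) (N : nat) (X : seq (seq A)) (a b : seq A) : Prop :=
  [/\ a \in X, b \in X
    & exists u v : seq (seq A),
      [/\ {subset u <= X} /\ {subset v <= X}, N <= size u, N <= size v
        & prefix_comparable (a ++ flatten u) (b ++ flatten v)]].

Lemma edgeC (A : eqType) N (X : seq (seq A)) a b : edge N X a b -> edge N X b a.
Proof.
case=> Xa Xb [u [v [[Xu Xv] Nu Nv cmp]]]; split=> //.
by exists v, u; rewrite prefix_comparableC.
Qed.

Definition linked (A : eqType) N (X : seq (seq A)) : seq A -> seq A -> Prop :=
  clos_refl_sym_trans _ (edge N X).

Definition length_sum (A : Type) (X : seq (seq A)) : nat :=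
  \sum_(x <- X) size x.

Definition linked_to (A : eqType) N (X T : seq (seq A)) : Prop :=
  forall x, x \in X -> exists2 t, t \in T & linked N X x t.

(** When [a = b ++ r], replacing [a] by [r] keeps all words of [X] as products
    and does not create components. Indeed every product of words of [X] that
    begins by [a] begins by [b] in the new list, so that [b] takes over the
    edges of [a]; and cancelling [b] in the edge between [a] and [b] links the
    new word [r] to some old word. *)
Lemma edge_reduction (A : eqType) N (X : seq (seq A)) a b r :
  uniq X -> [::] \notin X -> length_sum X <= N.+1 ->
  edge N.+1 X a b -> a != b -> a = b ++ r ->
  exists X', [/\ uniq X', [::] \notin X', length_sum X' <= N,
    forall T, linked_to N.+1 X T ->
      exists2 T', size T' = size T & linked_to N X' T'
  & forall x, x \in X -> star X' x].
Proof.
move=> uX nX sX eab neq_ab def_a.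
have [Xa Xb [u [v [[Xu Xv] Nu Nv cmp]]]] := eab.
have b0 : 0 < size b by case: (b) Xb nX => // -> .
have r0 : r != [::] by apply: contraNneq neq_ab => r0; rewrite def_a r0 cats0.
have ra : r != a.
  by apply/eqP => /(congr1 size)/eqP; rewrite def_a size_cat; lia.
pose X' := if r \in X then rem a X else r :: rem a X.
have Xr : r \in X'.
  by rewrite /X'; case: ifP => Xr; rewrite ?mem_head // mem_rem_uniq // inE ra.
have X'X x : x \in X -> x != a -> x \in X'.
  move=> Xx xa; have xr: x \in rem a X by rewrite mem_rem_uniq // inE xa.
  by rewrite /X'; case: ifP => _ //; rewrite inE xr orbT.
have X'E x : x \in X' -> x = r \/ x \in X /\ x != a.
  rewrite /X'; case: ifP => _; rewrite ?inE mem_rem_uniq // inE.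
    by case/andP; right.
  by case/orP=> [/eqP|/andP[]]; [left|right].
(* The first block in [X'] of a product of words of [X] that begins by [x]. *)
pose rho x := if x == a then b else x.
have X'rho x : x \in X -> rho x \in X'.
  by rewrite /rho; case: eqP => [_ _|/eqP xa Xx]; apply: X'X; rewrite // eq_sym.
(* Rewriting of a product of words of [X] as a product of words of [X']. *)
pose G (ws : seq (seq A)) :=
  flatten [seq if x == a then [:: b; r] else [:: x] | x <- ws].
have GE ws : flatten (G ws) = flatten ws.
  elim: ws => //= x ws IH; rewrite /G /= flatten_cat -/(G ws) IH.
  by case: eqP => [->|_] /=; rewrite cats0 // def_a.
have Gsz ws : size ws <= size (G ws).
  by elim: ws => //= x ws; rewrite /G /= size_cat; case: eqP => //=; lia.
have GX ws : {subset ws <= X} -> {subset G ws <= X'}.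
  elim: ws => [|x ws IH] Xws y; rewrite /G // -/G /= mem_cat => /orP[].
    case: eqP => [_|/eqP xa]; rewrite !inE.
      by case/orP=> /eqP-> //; apply: X'X; rewrite // eq_sym.
    by move/eqP=> ->; apply: X'X => //; apply: Xws; rewrite mem_head.
  by apply: IH => t tws; apply: Xws; rewrite inE tws orbT.
have GP c ws : c \in X -> {subset ws <= X} ->
    exists ws', [/\ {subset ws' <= X'}, size ws <= size ws'
      & c ++ flatten ws = rho c ++ flatten ws'].
  move=> Xc Xws; rewrite /rho; case: eqP => [->|_].
    exists (r :: G ws) => /=; split.
    - by move=> x; rewrite inE => /orP[/eqP->|/GX->].
    - by rewrite ltnW // ltnS.
    - by rewrite GE def_a catA.
  by exists (G ws); rewrite GE; split=> //; apply: GX.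
have rhoE c d : edge N.+1 X c d -> edge N X' (rho c) (rho d).
  case=> Xc Xd [u1 [v1 [[Xu1 Xv1] Nu1 Nv1]]].
  have [u2 [Xu2 su2 ->]] := GP c u1 Xc Xu1.
  have [v2 [Xv2 sv2 ->]] := GP d v1 Xd Xv1.
  move=> cmp1; split; [exact: X'rho|exact: X'rho|exists u2, v2; split=> //].
    exact: leq_trans (ltnW Nu1) su2.
  exact: leq_trans (ltnW Nv1) sv2.
have rhoL c d : linked N.+1 X c d -> linked N X' (rho c) (rho d).
  elim=> [c' d' /rhoE|c'|c' d' _|c' d' e' _ IH1 _ IH2].
  - exact: rst_step.
  - exact: rst_refl.
  - exact: rst_sym.
  - exact: rst_trans IH1 IH2.
exists X'; split.
- rewrite /X'; case: ifPn => Xr'; rewrite /= rem_uniq // andbT.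
  by apply: contra Xr' => /mem_rem.
- rewrite /X'; case: ifPn => _; first by apply: contra nX => /mem_rem.
  by rewrite inE eq_sym (negPf r0); apply: contra nX => /mem_rem.
- have : length_sum X = size a + length_sum (rem a X).
    by rewrite /length_sum (perm_big _ (perm_to_rem Xa)) /= big_cons.
  have ea : size a = size b + size r by rewrite def_a size_cat.
  rewrite /X'; case: ifP => _; rewrite /length_sum ?big_cons;
    by move: sX; rewrite /length_sum; lia.
- move=> T linkT; exists (map rho T); first by rewrite size_map.
  have linkX x : x \in X -> exists2 t, t \in map rho T & linked N X' (rho x) t.
    move=> /linkT[t Tt lt]; exists (rho t); [exact: map_f|exact: rhoL].
  move=> x /X'E[->|[Xx xa]]; last first.
    by have := linkX x Xx; rewrite [rho x]ifN.
  (* For [r], cancel [b] on both sides of the edge between [a] and [b]. *)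
  case: v Xv Nv cmp => // g v Xv Nv.
  rewrite {1}def_a -catA prefix_comparable_cat2l /=.
  have Xg : g \in X by apply: Xv; rewrite mem_head.
  have [|v' [Xv' sv' ->]] := GP g v Xg.
    by move=> y yv; apply: Xv; rewrite inE yv orbT.
  move=> cmp; have [t Tt lt] := linkX g Xg; exists t => //.
  apply: rst_trans lt; apply: rst_step; split=> //; first exact: X'rho.
  exists (G u), v'; rewrite GE; split=> //; first by split=> //; apply: GX.
    exact: leq_trans (ltnW Nu) (Gsz u).
  exact: leq_trans sv'.
- move=> x Xx; have [->|xa] := eqVneq x a; last exact/star1/X'X.
  rewrite def_a; apply: star_cat; apply: star1 => //; apply: X'X => //.
  by rewrite eq_sym.
Qed.

(** A defect theorem: [X] consists of products of at most as many words as its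
    graph has connected components, [T] being a system of representatives of
    them. Each edge between distinct words is contracted by [edge_reduction]; a
    graph without such edges has one component for each word. *)
Lemma defect (A : eqType) N (X T : seq (seq A)) :
  uniq X -> [::] \notin X -> length_sum X <= N -> linked_to N X T ->
  exists2 Y, size Y <= size T & forall x, x \in X -> star Y x.
Proof.
elim: N X T => [|N IH] X T uX nX sX linkT.
  exists T => // x Xx; move: sX.
  rewrite /length_sum (perm_big _ (perm_to_rem Xx)) big_cons.
  by case: x Xx => [Xx|//]; rewrite Xx in nX.
have [[a [b [eab neq_ab]]]|triv] :=
    classic (exists a b, edge N.+1 X a b /\ a != b); last first.
  exists T => // x /linkT[t Tt lt]; suff -> : x = t by exact: star1.
  elim: lt => // [c d ecd|c d e _ -> _ ->] //.
  by apply/eqP/negP => /negP neq; apply: triv; exists c, d.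
suff [X' [uX' nX' sX' linkX' starX']] : exists X',
    [/\ uniq X', [::] \notin X', length_sum X' <= N,
      forall T, linked_to N.+1 X T ->
        exists2 T', size T' = size T & linked_to N X' T'
    & forall x, x \in X -> star X' x].
  have [T' <- linkT'] := linkX' T linkT.
  have [Y sY starY] := IH X' T' uX' nX' sX' linkT'; exists Y => // x /starX'.
  case=> ws Xws ->; apply: star_flatten => w /Xws; exact: starY.
have : prefix_comparable a b.
  by case: eab => _ _ [u [v [_ _ _ /prefix_comparable_catW]]].
case/orP=> /prefixP[r def_r].
  by apply: (edge_reduction uX nX sX (edgeC eab) _ def_r); rewrite eq_sym.
exact: (edge_reduction uX nX sX eab _ def_r).
Qed.

(** * Elementary lists *)

(** The words of [X] are the images of the letters under an elementary
    morphism: they do not factor through a smaller alphabet. *)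
Definition elementary (A : eqType) (X : seq (seq A)) : Prop :=
  forall Z : seq (seq A), (forall x, x \in X -> star Z x) -> size X <= size Z.

Lemma elementary_uniq (A : eqType) (X : seq (seq A)) : elementary X -> uniq X.
Proof.
move=> elX; rewrite -[uniq X]negbK -ltn_size_undup -leqNgt; apply: elX => x Xx.
by apply: star1; rewrite mem_undup.
Qed.

Lemma elementary_nil (A : eqType) (X : seq (seq A)) :
  elementary X -> [::] \notin X.
Proof.
move=> elX; apply/negP => X0.
have := elX (rem [::] X); rewrite size_rem //.
have : 0 < size X by case: (X) X0.
suff star' x : x \in X -> star (rem [::] X) x.
  by move=> + /(_ star') => s0; rewrite -ltnS prednK // ltnn.
move=> Xx; have [->|x0] := eqVneq x [::]; first by exists [::].
by apply: star1; rewrite mem_rem_uniq ?elementary_uniq // inE x0.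
Qed.

Definition starts_with (A : eqType) (X : seq (seq A)) N (a w : seq A) : Prop :=
  exists ws, [/\ {subset ws <= X}, N <= size ws & w = a ++ flatten ws].

Lemma edge_starts_with (A : eqType) N (X : seq (seq A)) a b u v :
  a \in X -> b \in X -> starts_with X N a u -> starts_with X N b v ->
  prefix_comparable u v -> edge N X a b.
Proof.
move=> Xa Xb [us [Xu Nu ->]] [vs [Xv Nv ->]] cmp; split=> //.
by exists us, vs.
Qed.

Lemma starts_withS (A : eqType) N (X X' : seq (seq A)) a u :
  {subset X <= X'} -> starts_with X N a u -> starts_with X' N a u.
Proof. by move=> XX' [us [Xu Nu ->]]; exists us; split=> // x /Xu/XX'. Qed.

(** An edge between [a] and [b] would let [X] without [a] represent all
    components. *)
Lemma elementary_inj (A : eqType) N (X : seq (seq A)) a b u v :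
  elementary X -> length_sum X <= N -> a \in X -> b \in X ->
  starts_with X N a u -> starts_with X N b v -> prefix_comparable u v -> a = b.
Proof.
move=> elX sX Xa Xb au bv cmp; apply/eqP/negP => /negP neq_ab.
have uX := elementary_uniq elX.
have [||||Y sY starY] := @defect _ N X (rem a X); rewrite ?elementary_nil //.
  move=> x Xx; have [->|xa] := eqVneq x a.
    exists b; first by rewrite mem_rem_uniq // inE eq_sym neq_ab.
    exact/rst_step/(edge_starts_with Xa Xb au bv).
  by exists x; [rewrite mem_rem_uniq // inE xa|apply: rst_refl].
have := elX Y starY; move: sY; rewrite size_rem //.
by case: (X) Xa => //= *; lia.
Qed.

(** With [z] added to [X], the words [a] and [b] are both linked to [z]; if they
    were distinct, then [z] and the other words of [X] would represent all
    components, and there are fewer of them than words in [X]. *)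
Lemma elementary_delay (A : eqType) N (X : seq (seq A)) z a b u v u' v' :
  elementary X -> length_sum X + size z <= N -> z != [::] ->
  a \in X -> b \in X ->
  starts_with X N a u -> starts_with X N z u' -> prefix_comparable u u' ->
  starts_with X N b v -> starts_with X N z v' -> prefix_comparable v v' ->
  a = b.
Proof.
move=> elX sX z0 Xa Xb au zu' cmpu bv zv' cmpv; apply/eqP/negP => /negP neq_ab.
have uX := elementary_uniq elX.
pose X1 := if z \in X then X else z :: X.
have XX1 : {subset X <= X1}.
  by move=> x Xx; rewrite /X1; case: ifP => // _; rewrite inE Xx orbT.
have X1z : z \in X1 by rewrite /X1; case: ifP => // _; rewrite mem_head.
have X1E x : x \in X1 -> x = z \/ x \in X.
  rewrite /X1; case: ifP => _; rewrite ?inE; first by right.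
  by case/orP=> [/eqP|]; auto.
have edge_z c w w' : c \in X -> starts_with X N c w -> starts_with X N z w' ->
    prefix_comparable w w' -> edge N X1 c z.
  move=> Xc /(starts_withS XX1) cw /(starts_withS XX1) zw'.
  exact: edge_starts_with (XX1 c Xc) X1z cw zw'.
have [||||Y sY starY] := @defect _ N X1 (z :: rem b (rem a X)).
- by rewrite /X1; case: ifPn => //= zX; rewrite ?zX.
- rewrite /X1; case: ifP => _; rewrite ?inE ?negb_or ?elementary_nil //.
  by rewrite eq_sym z0.
- by rewrite /X1; case: ifP => _; move: sX; rewrite /length_sum ?big_cons; lia.
- move=> x /X1E[->|Xx]; first by exists z; [rewrite mem_head|apply: rst_refl].
  have [->|xa] := eqVneq x a.
    by exists z; [rewrite mem_head|apply/rst_step/(edge_z _ _ _ _ au zu')].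
  have [->|xb] := eqVneq x b.
    by exists z; [rewrite mem_head|apply/rst_step/(edge_z _ _ _ _ bv zv')].
  exists x; last exact: rst_refl.
  rewrite inE mem_rem_uniq ?rem_uniq // inE xb.
  by rewrite mem_rem_uniq // inE xa Xx orbT.
have := elX Y; move: sY.
have rXb : b \in rem a X by rewrite mem_rem_uniq // inE eq_sym neq_ab.
have sX2 : 0 < size (rem a X) by case: (rem a X) rXb.
rewrite /= size_rem // prednK // size_rem // => sY.
move=> /(_ (fun x Xx => starY x (XX1 x Xx))).
by case: (X) Xa sY => //= *; lia.
Qed.

(** * Factorizations of bi-infinite sequences *)

Import Order.TTheory GRing.Theory Num.Theory.
Local Open Scope ring_scope.

Lemma prefix_comparable_factor (A : eqType) (y : int -> A) n m m' :
  prefix_comparable (factor y n m) (factor y n m').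
Proof.
rewrite /prefix_comparable; have [le_m|/ltnW le_m] := leqP m m';
  apply/orP; [left|right];
  by rewrite -(subnKC le_m) factorD prefix_prefix.
Qed.

Lemma size_factor (A : Type) (y : int -> A) n m : size (factor y n m) = m.
Proof. exact: size_mkseq. Qed.

Definition next_ok (A : eqType) (p q : seq A * nat) : bool :=
  if (p.2.+1 < size p.1)%N then q == (p.1, p.2.+1) else q.2 == 0%N.

(** A factorization of [y] over [X], given by local data: [s n] consists of the
    block that covers position [n] and of the offset of [n] in this block. In
    this form it is a family of constraints on neighbours, to which compactness
    applies, and it takes finitely many values. *)
Definition parse (A : eqType) (X : seq (seq A)) (y : int -> A)
    (s : int -> seq A * nat) : Prop :=
  forall n : int,
    [/\ (s n).1 \in X, ((s n).2 < size (s n).1)%N,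
        nth (y n) (s n).1 (s n).2 = y n & next_ok (s n) (s (n + 1))].

Lemma parse_inside (A : eqType) (X : seq (seq A)) y s n m :
  parse X y s -> ((s n).2 + m < size (s n).1)%N ->
  s (n + m%:Z) = ((s n).1, ((s n).2 + m)%N).
Proof.
move=> sP; elim: m => [|m IH] lt_m; first by rewrite addr0 addn0; case: (s n).
have := sP (n + m%:Z); rewrite IH; last by lia.
case=> _ _ _; rewrite /next_ok /= -addnS lt_m => /eqP <-.
by congr (s _); lia.
Qed.

Lemma parse_end (A : eqType) (X : seq (seq A)) y s n :
  parse X y s -> (s (n + (size (s n).1 - (s n).2)%:Z)).2 = 0%N.
Proof.
move=> sP; have [_ lt_s _ _] := sP n; set m := (_ - _)%N.
have := sP (n + m.-1%:Z); rewrite (parse_inside sP) => [[_ _ _]|].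
  rewrite /next_ok /= ltnNge ifF => [/eqP <-|].
    by congr (s _).2; rewrite /m; lia.
  by apply/negbF; rewrite /m; lia.
by rewrite /m; lia.
Qed.

Lemma parse_factor (A : eqType) (X : seq (seq A)) y s n :
  parse X y s -> factor y n (size (s n).1 - (s n).2) = drop (s n).2 (s n).1.
Proof.
move=> sP; apply: (@eq_from_nth _ (y n)) => [|m].
  by rewrite size_factor size_drop.
rewrite size_factor => lt_m; rewrite nth_mkseq // nth_drop.
have [_ + + _] := sP (n + m%:Z); rewrite (parse_inside sP) /=; last by lia.
by move=> lt_s <-; apply: set_nth_default.
Qed.

Lemma parse_starts_with (A : eqType) (X : seq (seq A)) y s N n :
  parse X y s ->
  exists m, starts_with X N (drop (s n).2 (s n).1) (factor y n m).
Proof.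
move=> sP; elim: N n => [|N IH] n.
  exists (size (s n).1 - (s n).2)%N, [::]; split=> //.
  by rewrite (parse_factor _ sP) cats0.
set k := (size (s n).1 - (s n).2)%N.
have [m [ws [Xws Nws def_m]]] := IH (n + k%:Z).
exists (k + m)%N, ((s (n + k%:Z)).1 :: ws); split=> // [x|].
  by rewrite inE => /orP[/eqP->|/Xws//]; have [] := sP (n + k%:Z).
rewrite factorD (parse_factor _ sP) def_m /= [in LHS]/k (parse_end _ sP) drop0.
by [].
Qed.

Lemma size_length_sum (A : eqType) (X : seq (seq A)) w :
  w \in X -> (size w <= length_sum X)%N.
Proof.
move=> Xw; rewrite /length_sum (perm_big _ (perm_to_rem Xw)) big_cons /=.
exact: leq_addr.
Qed.

Lemma parse_inj (A : eqType) (X : seq (seq A)) y s s' n :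
  elementary X -> parse X y s -> parse X y s' ->
  (s n).2 = 0%N -> (s' n).2 = 0%N -> s n = s' n.
Proof.
move=> elX sP sP' s0 s0'.
have [m] := parse_starts_with (length_sum X) n sP.
have [m'] := parse_starts_with (length_sum X) n sP'.
rewrite s0 s0' !drop0 => fw' fw.
have [Xs _ _ _] := sP n; have [Xs' _ _ _] := sP' n.
have := elementary_inj elX (leqnn _) Xs Xs' fw fw'
  (prefix_comparable_factor _ _ _ _).
by case: (s n) (s' n) s0 s0' => [w j] [w' j'] /= -> -> ->.
Qed.

(** Inside a block agreement is preserved trivially, and at the end of a common
    block both factorizations cut, so that [parse_inj] applies. *)
Lemma parse_synchronized (A : eqType) (X : seq (seq A)) y s s' n (m : nat) :
  elementary X -> parse X y s -> parse X y s' ->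
  s n = s' n -> s (n + m%:Z) = s' (n + m%:Z).
Proof.
move=> elX sP sP' eq_s; elim: m => [|m IH]; first by rewrite addr0.
have -> : n + m.+1%:Z = n + m%:Z + 1 by lia.
have [_ _ _] := sP (n + m%:Z); have [_ _ _] := sP' (n + m%:Z).
rewrite /next_ok IH; case: ifP => _ => [/eqP-> /eqP->//|/eqP s0' /eqP s0].
exact: parse_inj sP sP' s0 s0'.
Qed.

(** If [s] reaches the end of its block while [s'] does not, the remainder of
    the block of [s'] determines the next block of [s] by [elementary_delay]. *)
Lemma parse_delay (A : eqType) (X : seq (seq A)) y s s' m n :
  elementary X -> parse X y s -> parse X y s' ->
  s m = s n -> s' m = s' n -> ((s' m).2.+1 < size (s' m).1)%N ->
  s (m + 1) = s (n + 1).
Proof.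
move=> elX sP sP' eq_s eq_s' lt_s'.
have [_ _ _] := sP m; have [_ _ _] := sP n; rewrite /next_ok -eq_s.
case: ifP => _ => [/eqP-> /eqP->//|/eqP sn0 /eqP sm0].
pose z := drop (s' m).2.+1 (s' m).1; have [Xs' _ _ _] := sP' m.
have z0 : z != [::] by rewrite -size_eq0 size_drop; lia.
have sz : (size z <= length_sum X)%N.
  by rewrite size_drop (leq_trans (leq_subr _ _)) // size_length_sum.
pose N := (length_sum X + length_sum X)%N.
have sN : (length_sum X + size z <= N)%N by rewrite leq_add2l.
have [_ _ _] := sP' m; have [_ _ _] := sP' n.
rewrite /next_ok -eq_s' lt_s' => /eqP s'n /eqP s'm.
have [m1 fm] := parse_starts_with N (m + 1) sP.
have [m2 fm'] := parse_starts_with N (m + 1) sP'.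
have [n1 fn] := parse_starts_with N (n + 1) sP.
have [n2 fn'] := parse_starts_with N (n + 1) sP'.
move: fm fm' fn fn'; rewrite s'm s'n sn0 sm0 /= !drop0 -/z => fm fm' fn fn'.
have [Xm _ _ _] := sP (m + 1); have [Xn _ _ _] := sP (n + 1).
have := elementary_delay elX sN z0 Xm Xn
  fm fm' (prefix_comparable_factor _ _ _ _)
  fn fn' (prefix_comparable_factor _ _ _ _).
by case: (s (m + 1)) (s (n + 1)) sm0 sn0 => [w j] [w' j'] /= -> -> ->.
Qed.

(** Determinism of the pair of states: by [parse_delay] it can fail only where
    both factorizations cut, and there they agree by [parse_inj]. *)
Lemma parse_pair_next (A : eqType) (X : seq (seq A)) y s s' m n :
  elementary X -> parse X y s -> parse X y s' ->
  s m = s n -> s' m = s' n -> s (m + 1) != s' (m + 1) ->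
  s (m + 1) = s (n + 1) /\ s' (m + 1) = s' (n + 1).
Proof.
move=> elX sP sP' eq_s eq_s' neq.
have inside r : parse X y r -> r m = r n -> ((r m).2.+1 < size (r m).1)%N ->
    r (m + 1) = r (n + 1).
  move=> rP eq_r lt_r; have [_ _ _] := rP m; have [_ _ _] := rP n.
  by rewrite /next_ok -eq_r lt_r => /eqP-> /eqP->.
have [lt_s|end_s] := boolP ((s m).2.+1 < size (s m).1)%N.
  by split; [apply: inside|apply: (parse_delay elX sP' sP)].
have [lt_s'|end_s'] := boolP ((s' m).2.+1 < size (s' m).1)%N.
  by split; [apply: (parse_delay elX sP sP')|apply: inside].
case/eqP: neq; apply: (parse_inj elX sP sP').
  by have [_ _ _] := sP m; rewrite /next_ok (negPf end_s) => /eqP.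
by have [_ _ _] := sP' m; rewrite /next_ok (negPf end_s') => /eqP.
Qed.

Lemma finite_repeat (T : eqType) (Q : seq T) (f : int -> T) (N : int) :
  (forall n, f n \in Q) ->
  exists (i : int) (d : nat),
    [/\ (0 < d <= size Q)%N, i + d%:Z <= N & f i = f (i + d%:Z)].
Proof.
move=> Qf; pose g j := f (N - (size Q)%:Z + j%:Z).
have : ~~ uniq (mkseq g (size Q).+1).
  apply/negP => /uniq_leq_size leQ.
  have /leQ : {subset mkseq g (size Q).+1 <= Q}.
    by move=> x /mapP[j _ ->]; apply: Qf.
  by rewrite size_mkseq ltnn.
case/(uniqPn (f 0)) => i [j [lt_ij]]; rewrite size_mkseq => lt_j.
rewrite !nth_mkseq ?(ltn_trans lt_ij) // => eq_g.
exists (N - (size Q)%:Z + i%:Z), (j - i)%N; split; try lia.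
by rewrite -/(g i) eq_g; congr (f _); lia.
Qed.

(** The period [d] depends on [N], but [K`!] is a multiple of each of them. *)
Lemma periodic_tails (T : Type) (y : int -> T) (K : nat) :
  (0 < K)%N ->
  (exists n0 : int, forall N, N <= n0 -> exists (i : int) (d : nat),
    [/\ (0 < d <= K)%N, i <= N
      & forall t : nat, y (i + t%:Z) = y (i + t%:Z + d%:Z)]) ->
  periodic y.
Proof.
move=> K0 [n0 perN]; exists K`!; first exact: fact_gt0.
move=> n; rewrite -shiftz_nat /shiftz.
have [|i [d [dK le_i per]]] := perN (Num.min n n0); first by lia.
have /dvdnP[e ->] : (d %| K`!)%N by apply: dvdn_fact.
have [t ->] : exists t : nat, n = i + t%:Z by exists `|n - i|%N; lia.
elim: e => [|e IH]; first by rewrite addr0.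
have -> : i + t%:Z + (e.+1 * d)%N%:Z = i + (t + e * d)%N%:Z + d%:Z.
  by rewrite mulSn; lia.
by rewrite -per -IH; congr y; lia.
Qed.

(** Uniqueness of factorizations over an elementary list. If the factorizations
    disagree at [n0], they disagree on all its left by [parse_synchronized]. A
    pair of states repeated at distance [d] there is reproduced forever by
    [parse_pair_next], provided that the factorizations never agree; a first
    agreement at [i + t] with [t > d] would have occurred already at
    [i + t - d]. *)
Theorem parse_unique (A : eqType) (X : seq (seq A)) y s s' :
  elementary X -> aperiodic y -> parse X y s -> parse X y s' -> s =1 s'.
Proof.
move=> elX aper sP sP' n0; apply/eqP/negP => /negP neq0; apply: aper.
have neq n : n <= n0 -> s n != s' n.
  move=> le_n; apply: contra neq0 => /eqP eq_n.
  have -> : n0 = n + `|n0 - n|%N%:Z by lia.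
  exact/eqP/(parse_synchronized _ elX sP sP').
pose P := [seq (w, j) | w <- X, j <- iota 0 (length_sum X)].
have inP r n : parse X y r -> r n \in P.
  move=> rP; have [Xr lt_r _ _] := rP n; rewrite [r n]surjective_pairing.
  by apply: allpairs_f; rewrite // mem_iota (leq_trans lt_r) // size_length_sum.
pose Q := [seq (p, q) | p <- P, q <- P].
have inQ n : (s n, s' n) \in Q by apply: allpairs_f; apply: inP.
apply: (@periodic_tails _ _ (size Q)).
  by case: (Q) (inQ 0).
exists n0 => N le_N.
have [i [d [dQ le_i [eq_s eq_s']]]] := finite_repeat N inQ.
exists i, d; split=> //; first by lia.
suff st (t : nat) : s (i + t%:Z) != s' (i + t%:Z) /\
    s (i + t%:Z) = s (i + t%:Z + d%:Z) /\ s' (i + t%:Z) = s' (i + t%:Z + d%:Z).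
  move=> t; have [_ [eq_t _]] := st t.
  have [_ lt1 <- _] := sP (i + t%:Z); have [_ _ <- _] := sP (i + t%:Z + d%:Z).
  by rewrite -eq_t; apply: set_nth_default.
elim/ltn_ind: t => t IH.
have neq_t : s (i + t%:Z) != s' (i + t%:Z).
  have [le_t|lt_t] := leqP t d; first by apply: neq; lia.
  have [|+ [+ +]] := IH (t - d)%N; first by lia.
  have -> : i + (t - d)%N%:Z + d%:Z = i + t%:Z by lia.
  by move=> + <- <-.
split=> //; case: t IH neq_t => [|t] IH neq_t; first by rewrite addr0.
have [//|_ [eq_t eq_t']] := IH t.
have e1 : i + t.+1%:Z = i + t%:Z + 1 by lia.
have e2 : i + t.+1%:Z + d%:Z = i + t%:Z + d%:Z + 1 by lia.
rewrite e2 e1; apply: (parse_pair_next elX sP sP' eq_t eq_t').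
by rewrite -e1.
Qed.

(** * A minimal factorization of the powers of the morphism *)

Lemma morph_flatten (A : Type) (sigma : seq A -> seq A) ws :
  word_morphism sigma -> sigma (flatten ws) = flatten (map sigma ws).
Proof. by case=> sigma0 sigmaM; elim: ws => //= w ws <-. Qed.

Lemma morph_iter (A : Type) (sigma : seq A -> seq A) n :
  word_morphism sigma -> word_morphism (iter n sigma).
Proof.
case=> sigma0 sigmaM; elim: n => [|n [IH0 IHM]]; first by split.
by split=> [|u v]; rewrite !iterS ?IH0 // IHM sigmaM.
Qed.

Lemma morph_star (A : eqType) (sigma : seq A -> seq A) Y w :
  word_morphism sigma -> (forall a, star Y (sigma [:: a])) -> star Y (sigma w).
Proof.
case=> sigma0 sigmaM starY; elim: w => [|a w IH].
  by rewrite sigma0; exists [::].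
by rewrite -cat1s sigmaM; apply: star_cat.
Qed.

Lemma ex_least (P : nat -> Prop) n :
  P n -> exists2 m, P m & forall m', P m' -> (m <= m')%N.
Proof.
elim/ltn_ind: n => n IH Pn.
have [[m [Pm lt_mn]]|least] := classic (exists m, P m /\ (m < n)%N).
  exact: IH lt_mn Pm.
exists n => // m Pm; rewrite leqNgt; apply/negP => lt_mn.
by apply: least; exists m.
Qed.

(** If [Y] is shortest over all exponents, then a list [Z] whose products
    include [map sigma Y] also serves as a factorization of the power [n.+1],
    hence is not shorter than [Y]. *)
Lemma least_factorization (A : finType) (sigma : seq A -> seq A) :
  word_morphism sigma ->
  exists (n : nat) (Y : seq (seq A)),
    (forall a, star Y (iter n sigma [:: a])) /\ elementary (map sigma Y).
Proof.
move=> sigmaP.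
pose P m := exists (n : nat) (Y : seq (seq A)),
  size Y = m /\ forall a, star Y (iter n sigma [:: a]).
have [|m [n [Y [sY starY]]] least] := @ex_least P #|A|.
  exists 0%N, [seq [:: a] | a <- enum A]; rewrite size_map -cardE; split=> // a.
  by apply/star1/map_f; rewrite mem_enum.
exists n, Y; split=> // Z starZ; rewrite size_map sY; apply: least.
exists n.+1, Z; split=> // a; have [ws Yws def_a] := starY a.
rewrite iterS def_a morph_flatten //.
apply: star_flatten => _ /mapP[w /Yws Yw ->].
exact/starZ/map_f.
Qed.

(** * Compactness and desubstitution *)

(** Koenig's lemma: grow a prefix that is shared by infinitely many of the
    sequences [t N]; the finiteness of [L] always allows one more step. *)
Lemma koenig (T : eqType) (L : seq T) (t : nat -> nat -> T) :
  (forall N k, t N k \in L) ->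
  exists u : nat -> T, forall k N0,
    exists2 N, (N0 <= N)%N & forall j, (j < k)%N -> t N j = u j.
Proof.
move=> Lt; pose G (p : seq T) :=
  forall N0, exists2 N, (N0 <= N)%N & mkseq (t N) (size p) = p.
have extend p : exists q, G p -> G (rcons p q).
  apply: NNPP => /not_ex_all_not noq.
  have Gp : G p by apply: NNPP => nGp; apply: (noq (t 0 0)%N).
  have bad q : exists N0, forall N, (N0 <= N)%N ->
      mkseq (t N) (size p).+1 <> rcons p q.
    apply: NNPP => nb; apply: (noq q) => _ N0; apply: NNPP => nN.
    apply: nb; exists N0 => N le_N eqN; apply: nN; exists N => //.
    by rewrite size_rcons.
  have [N0 badN0] : exists N0, forall q, q \in L -> forall N, (N0 <= N)%N ->
      mkseq (t N) (size p).+1 <> rcons p q.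
    elim: (L) => [|q L' [N1 IH]]; first by exists 0%N.
    have [N2 badN2] := bad q; exists (maxn N1 N2) => q'; rewrite inE.
    case/orP=> [/eqP->|L'q'] N; rewrite geq_max => /andP[le1 le2].
      exact: badN2.
    exact: IH.
  have [N le_N eqN] := Gp N0.
  by apply: (badN0 _ (Lt N (size p)) N le_N); rewrite mkseqS eqN.
have [e eP] := functional_choice _ extend.
pose pf k := iter k (fun p => rcons p (e p)) [::].
have pfP k : G (pf k) by elim: k => [N0|k IH]; [exists N0|apply: eP].
pose u k := e (pf k).
have pfE k : pf k = mkseq u k by elim: k => // k IH; rewrite mkseqS -IH.
exists u => k N0; have [N le_N] := pfP k N0; rewrite pfE size_mkseq => eqN.
exists N => // j lt_j; have := congr1 (nth (u j) ^~ j) eqN.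
by rewrite !nth_mkseq.
Qed.

Lemma koenigZ (T : eqType) (L : seq T) (t : nat -> int -> T) :
  (forall N n, t N n \in L) ->
  exists u : int -> T, forall M N0 : nat,
    exists2 N, (N0 <= N)%N & forall n : int, - M%:Z <= n < M%:Z -> t N n = u n.
Proof.
move=> Lt; pose t' N k := (t N k%:Z, t N (Negz k)).
have [N k|u uP] := @koenig _ [seq (p, q) | p <- L, q <- L] t'.
  exact: allpairs_f.
exists (fun n => match n with Posz k => (u k).1 | Negz k => (u k).2 end).
move=> M N0; have [N le_N eqN] := uP M N0; exists N => // -[] k lt_k.
  by rewrite -eqN //; lia.
by rewrite -eqN //; lia.
Qed.

(** The states of [parse] along a finite product of blocks. *)
Definition positions (A : eqType) (ws : seq (seq A)) : seq (seq A * nat) :=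
  flatten [seq [seq (w, j) | j <- iota 0 (size w)] | w <- ws].

Lemma positionsP (A : eqType) (ws : seq (seq A)) x0 d k :
  [::] \notin ws -> (k < size (flatten ws))%N ->
  let p := nth d (positions ws) k in
  [/\ p.1 \in ws, (p.2 < size p.1)%N, nth x0 p.1 p.2 = nth x0 (flatten ws) k
    & (k.+1 < size (flatten ws))%N -> next_ok p (nth d (positions ws) k.+1)].
Proof.
elim: ws k => [|w ws IH] k //; rewrite inE negb_or eq_sym => /andP[w0 nws] /=.
rewrite /positions /= -/(positions ws) size_cat !nth_cat size_map size_iota.
have nth_w j : (j < size w)%N ->
    nth d [seq (w, j) | j <- iota 0 (size w)] j = (w, j).
  by move=> lt_j; rewrite (nth_map 0%N) ?size_iota // nth_iota.
have [lt_k|le_k] := ltnP k (size w) => lt_kw.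
  rewrite nth_w // mem_head; split=> // lt_k1; rewrite /next_ok /=.
  have [/nth_w -> //|ge_k] := ltnP k.+1 (size w).
  have -> : (k.+1 - size w = 0)%N by lia.
  case: ws nws lt_k1 {IH lt_kw} => [|w' ws]; first by rewrite addn0; lia.
  by rewrite inE negb_or eq_sym; case: w'.
have [|ws1 lt1 -> next1] := IH (k - size w)%N nws; first by lia.
split=> //; first by rewrite inE ws1 orbT.
by move=> lt_k1; rewrite ifF ?subSn //; [apply: next1; lia|lia].
Qed.

(** A factor too long for the words [sigma^l(a)] with [l < n] lies in some
    [sigma^n(sigma^(l-n)(a))]; so every factor is extended to such a length. *)
Lemma shift_factor_star (A : finType) (sigma : seq A -> seq A) Y n x i m :
  word_morphism sigma -> (forall a, star Y (iter n sigma [:: a])) ->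
  shift_of sigma x ->
  exists2 W, star Y W & infix (factor x i m) W.
Proof.
move=> sigmaP starY xP.
pose B := \max_(l < n) \max_(a : A) size (iter l sigma [:: a]).
have [l [a fw]] := xP i (m + B.+1)%N.
exists (iter l sigma [:: a]); last first.
  by apply: infix_trans fw; rewrite factorD; apply/prefixW/prefix_prefix.
have [le_nl|lt_ln] := leqP n l.
  by rewrite -(subnKC le_nl) iterD; apply: morph_star => //; apply: morph_iter.
have := size_infix fw; rewrite size_factor.
have : (size (iter l sigma [:: a]) <= B)%N.
  rewrite /B (bigD1 (Ordinal lt_ln)) //= (bigD1 a) //=.
  by rewrite -maxnA leq_maxl.
by move=> le_B /leq_trans/(_ le_B) lt_B; exfalso; lia.
Qed.

(** Each window of [x] lies in a finite product of blocks, whose states satisfy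
    the constraints of [parse] in the window; compactness gives states that
    satisfy all of them. *)
Lemma factors_parse (A : eqType) (Y : seq (seq A)) (x : int -> A) :
  [::] \notin Y ->
  (forall i m, exists2 W, star Y W & infix (factor x i m) W) ->
  exists s, parse Y x s.
Proof.
move=> nY xY.
pose K := length_sum Y.
pose L := [seq (w, j) | w <- Y, j <- iota 0 K].
pose ok (s : int -> seq A * nat) N := forall k, - N%:Z <= k < N%:Z ->
  [/\ (s k).1 \in Y, ((s k).2 < size (s k).1)%N, nth (x k) (s k).1 (s k).2 = x k
    & k + 1 < N%:Z -> next_ok (s k) (s (k + 1))].
have window N :
    exists s : int -> seq A * nat, (forall k, s k \in L) /\ ok s N.+1.
  have [W [ws Yws ->] /infixP[u [v def_ws]]] :=
    xY (- N.+1%:Z) (N.+1 + N.+1)%N.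
  have nws : [::] \notin ws by apply: contra nY => /Yws.
  have sws : size (flatten ws) = (size u + (N.+1 + N.+1 + size v))%N.
    by rewrite def_ws !size_cat size_factor.
  (* The default value keeps [s] in [L] beyond the end of the product. *)
  pose d := nth ([::], 0)%N (positions ws) (size u).
  pose s (k : int) := nth d (positions ws) (size u + `|(k + N.+1%:Z)%R|).
  have inL j : (j < size (flatten ws))%N ->
      nth ([::], 0)%N (positions ws) j \in L.
    move=> lt_j.
    have [/Yws w1 lt1 _ _] := positionsP (x 0) ([::], 0)%N nws lt_j.
    rewrite [nth _ _ _]surjective_pairing; apply: allpairs_f => //.
    by rewrite mem_iota (leq_trans lt1) // size_length_sum.
  have s_pos : size (positions ws) = size (flatten ws).
    rewrite /positions; elim: (ws) => //= w ws' IH.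
    by rewrite !size_cat IH size_map size_iota.
  exists s; split=> k.
    rewrite /s; set j := (_ + _)%N.
    have [lt_j|le_j] := ltnP j (size (flatten ws)).
      by rewrite (set_nth_default ([::], 0)%N) ?s_pos //; apply: inL.
    by rewrite nth_default ?s_pos //; apply: inL; lia.
  move=> k_in; pose j := `|(k + N.+1%:Z)%R|%N.
  have lt_j : (j < N.+1 + N.+1)%N by rewrite /j; lia.
  have [|/Yws s1 s2 s3 s4] := @positionsP _ ws (x k) d (size u + j) nws.
    by rewrite sws; lia.
  split=> //.
    rewrite s3 def_ws nth_cat ifF; last by rewrite ltnNge leq_addr.
    rewrite addKn nth_cat size_factor lt_j.
    by rewrite nth_mkseq //; congr x; rewrite /j; lia.
  move=> lt_k1; rewrite /s -/j.
  have -> : (size u + `|(k + 1 + N.+1%:Z)%R|)%N = (size u + j).+1.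
    by rewrite /j; lia.
  by apply: s4; rewrite sws /j; lia.
have [t tP] := functional_choice _ window.
have [|s sP] := @koenigZ _ L t; first by move=> N k; have [] := tP N.
exists s => k; pose M := (`|k| + 2)%N.
have [N le_N eqN] := sP M M; have [_ okN] := tP N.
have ek : t N k = s k by apply: eqN; rewrite /M; lia.
have ek1 : t N (k + 1) = s (k + 1) by apply: eqN; rewrite /M; lia.
have [|+ + + H] := okN k; first by move: le_N; rewrite /M; lia.
by rewrite -ek -ek1; split=> //; apply: H; move: le_N; rewrite /M; lia.
Qed.

(** * Factorization of the image *)

(** The image of [x], placed on [y]: the block [sigma (x i)] starts at position
    [P i] of [y]. *)
Definition image_at (A : Type) (sigma : seq A -> seq A) (x y : int -> A)
    (P : int -> int) : Prop :=
  [/\ forall i, P (i + 1) = P i + (size (sigma [:: x i]))%:Z,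
      forall i, factor y (P i) (size (sigma [:: x i])) = sigma [:: x i]
    & forall q, exists i, P i <= q < P (i + 1)].

Lemma factor1 (A : Type) (x : int -> A) i : factor x i 1 = [:: x i].
Proof. by congr [:: x _]; lia. Qed.

(** [P i + k] is the length of the image of [x_0 ... x_(i-1)], counted
    negatively on the left; both halves of the image being infinite, every
    position of [y] is covered. *)
Lemma representation_image (A : eqType) (sigma : seq A -> seq A) y x k :
  word_morphism sigma -> representation sigma y x k ->
  exists2 P, image_at sigma x y P & P 0 = - k.
Proof.
move=> [sigma0 sigmaM] [z [[infR infL] zR zL] yz].
pose P i : int := (match i with
  | Posz n => (size (image_right sigma x n))%:Z
  | Negz n => - (size (image_left sigma x n.+1))%:Z end) - k.
have rightS n :
    image_right sigma x n.+1 = image_right sigma x n ++ sigma [:: x n%:Z].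
  by rewrite /image_right -addn1 factorD add0r sigmaM factor1.
have leftS n :
    image_left sigma x n.+1 = sigma [:: x (Negz n)] ++ image_left sigma x n.
  rewrite /image_left -add1n factorD sigmaM factor1 add1n.
  congr (sigma [:: x _] ++ sigma (factor x _ n)).
  by lia.
have yE i n : factor y (i - k) n = factor z i n.
  by apply: eq_map => j; rewrite yz /shiftz; congr z; lia.
have right0 : image_right sigma x 0 = [::] by rewrite /image_right.
have left0 : image_left sigma x 0 = [::] by rewrite /image_left.
have P0 : P 0 = - k by rewrite -[0]/(Posz 0) /P right0 sub0r.
have PS i : P (i + 1) = P i + (size (sigma [:: x i]))%:Z.
  case: i => n.
    have -> : Posz n + 1 = Posz n.+1 by lia.
    by rewrite /P rightS size_cat; lia.
  rewrite {2}/P leftS size_cat; case: n => [|n].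
    by rewrite left0 addn0 (_ : _ + 1 = 0) // P0 /=; lia.
  have -> : Negz n.+1 + 1 = Negz n by lia.
  by rewrite /P; lia.
exists P => //; split=> //.
  case=> n; rewrite /P yE.
    have := zR n.+1; rewrite /= rightS size_cat factorD add0r => /eqP.
    by rewrite eqseq_cat ?size_factor // => /andP[_ /eqP].
  have := zL n.+1; rewrite /= {2 3}leftS size_cat factorD => /eqP.
  by rewrite eqseq_cat ?size_factor // => /andP[/eqP].
move=> q; pose M := `|(q + k)%R|%N.
have [n1 lt1] := infR M.+1; have [n2 lt2] := infL M.+1.
have lo : P (- n2%:Z) <= q.
  case: n2 lt2 => [|n2 lt2]; first by rewrite left0.
  by rewrite -NegzE /P; lia.
have : q < P (- n2%:Z + (n2 + n1)%N%:Z).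
  have -> : - n2%:Z + (n2 + n1)%N%:Z = n1%:Z by lia.
  by rewrite /P; lia.
elim: (n2 + n1)%N => [|m IH] lt_q; first by rewrite addr0 in lt_q; lia.
have [/IH//|le_q] := ltrP q (P (- n2%:Z + m%:Z)).
exists (- n2%:Z + m%:Z); rewrite le_q /=.
by have -> : - n2%:Z + m%:Z + 1 = - n2%:Z + m.+1%:Z by lia.
Qed.

Lemma image_at_factor (A : Type) (sigma : seq A -> seq A) x y P i n :
  word_morphism sigma -> image_at sigma x y P ->
  P (i + n%:Z) = P i + (size (sigma (factor x i n)))%:Z /\
  factor y (P i) (size (sigma (factor x i n))) = sigma (factor x i n).
Proof.
move=> [sigma0 sigmaM] [PS Pf _]; elim: n => [|n [IH1 IH2]].
  by rewrite addr0 [factor x i 0]/= sigma0 addr0.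
have -> : i + n.+1%:Z = i + n%:Z + 1 by lia.
rewrite -[in factor x _ _]addn1 factorD factor1 sigmaM size_cat PS IH1.
by split; [lia|rewrite factorD IH2 -IH1 Pf].
Qed.

Lemma image_at_le (A : Type) (sigma : seq A -> seq A) x y P i j :
  image_at sigma x y P -> i <= j -> P i <= P j.
Proof.
move=> [PS _ _] le_ij; have -> : j = i + `|j - i|%N%:Z by lia.
elim: `|j - i|%N => [|n IH]; first by rewrite addr0.
apply: le_trans IH _; have -> : i + n.+1%:Z = i + n%:Z + 1 by lia.
by rewrite PS; lia.
Qed.

(** [b] is the index in [x] of the first letter of the block whose image covers
    the position [p] of [y]. Blocks are never erased, so that [b] runs
    through consecutive blocks as [p] increases, whereas the index of the letter
    whose image covers [p] jumps over erased letters. *)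
Definition block_at (A : Type) (s : int -> seq A * nat) (P : int -> int)
    (p b : int) : Prop :=
  (s b).2 = 0%N /\ P b <= p < P (b + (size (s b).1)%:Z).

Lemma block_at_uniq (A : eqType) (sigma : seq A -> seq A) Y x y s P p b b' :
  parse Y x s -> image_at sigma x y P ->
  block_at s P p b -> block_at s P p b' -> b = b'.
Proof.
move=> sP xyP.
wlog lt_bb : b b' / b < b' => [wlt|] pb pb'.
  by have [lt|lt|//] := ltgtP b b'; [|apply/esym]; apply: wlt.
case: pb pb' => sb /andP[_ lt_p] [sb' /andP[le_p _]].
have := image_at_le (i := b + (size (s b).1)%:Z) (j := b') xyP.
have [?|lt_b'] := lerP (b + (size (s b).1)%:Z) b'.
  by move=> /(_ isT); lia.
have := @parse_inside _ _ _ _ b `|b' - b|%N sP.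
have -> : b + `|b' - b|%N%:Z = b' by lia.
rewrite sb add0n => inside _; move: sb'; rewrite inside /=; lia.
Qed.

Lemma block_start (A : eqType) (Y : seq (seq A)) x s i :
  parse Y x s -> s (i - (s i).2%:Z) = ((s i).1, 0%N).
Proof.
move=> sP; have [j def_j] : exists j, j = (s i).2 by eexists.
rewrite -def_j; elim: j i def_j => [|j IH] i def_j.
  by rewrite subr0 def_j -surjective_pairing.
have sE : s (i - 1) = ((s i).1, j).
  have [_ lt_s _] := sP (i - 1); rewrite subrK /next_ok.
  case: ifP => _ /eqP; last by rewrite -def_j.
  move=> si; move: def_j; rewrite si /= => -[->].
  by rewrite -surjective_pairing.
have := IH (i - 1); rewrite sE => /(_ erefl) <-; congr s; lia.
Qed.

Lemma block_factor (A : eqType) (Y : seq (seq A)) x s b j :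
  parse Y x s -> (s b).2 = 0%N -> (j <= size (s b).1)%N ->
  factor x b j = take j (s b).1.
Proof.
move=> sP sb le_j; have := parse_factor b sP; rewrite sb subn0 drop0.
rewrite -{1}(subnKC le_j) factorD => <-.
by rewrite take_size_cat ?size_factor.
Qed.

Lemma block_image (A : eqType) (sigma : seq A -> seq A) Y x y s P b j :
  word_morphism sigma -> parse Y x s -> image_at sigma x y P ->
  (s b).2 = 0%N -> (j <= size (s b).1)%N ->
  P (b + j%:Z) = P b + (size (sigma (take j (s b).1)))%:Z.
Proof.
move=> sigmaP sP xyP sb le_j; rewrite -(block_factor sP sb le_j).
by have [] := image_at_factor b j sigmaP xyP.
Qed.

Lemma block_at_index (A : eqType) (sigma : seq A -> seq A) Y x y s P p i :
  parse Y x s -> image_at sigma x y P -> P i <= p < P (i + 1) ->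
  block_at s P p (i - (s i).2%:Z).
Proof.
move=> sP xyP /andP[le_p lt_p].
rewrite /block_at (block_start _ sP); split=> //=.
have [_ lt_s _ _] := sP i.
rewrite (le_trans _ le_p) ?(lt_le_trans lt_p) //.
- by apply: (image_at_le xyP); lia.
- by apply: (image_at_le xyP); lia.
Qed.

Lemma block_at_ex (A : eqType) (sigma : seq A -> seq A) Y x y s P p :
  parse Y x s -> image_at sigma x y P -> exists b, block_at s P p b.
Proof.
move=> sP xyP; have [_ _ /(_ p)[i le_p]] := xyP.
by eexists; apply: (block_at_index sP xyP le_p).
Qed.

Lemma block_at_start (A : eqType) (sigma : seq A -> seq A) Y x y s P b :
  word_morphism sigma -> [::] \notin map sigma Y ->
  parse Y x s -> image_at sigma x y P -> (s b).2 = 0%N -> block_at s P (P b) b.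
Proof.
move=> sigmaP nY sP xyP sb; split=> //; rewrite lexx /=.
rewrite (block_image sigmaP sP xyP sb) // take_size ltrDl.
have [Yb _ _ _] := sP b; have : sigma (s b).1 != [::].
  by apply: contra nY => /eqP<-; apply: map_f.
by case: (sigma _).
Qed.

Lemma block_at_next (A : eqType) (sigma : seq A -> seq A) Y x y s P p b :
  word_morphism sigma -> [::] \notin map sigma Y ->
  parse Y x s -> image_at sigma x y P -> block_at s P p b ->
  let e := b + (size (s b).1)%:Z in
  if p + 1 < P e then block_at s P (p + 1) b
  else P e = p + 1 /\ block_at s P (p + 1) e.
Proof.
move=> sigmaP nY sP xyP [sb /andP[le_p lt_p]] /=.
case: ltrP => [lt_p1|le_p1]; first by split=> //; lia.
have eP : P (b + (size (s b).1)%:Z) = p + 1 by lia.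
split=> //; rewrite -{1}eP; apply: (block_at_start sigmaP nY sP xyP).
by have := parse_end b sP; rewrite sb subn0.
Qed.

(** Consecutive blocks of [x] have consecutive images in [y], which are nonempty
    and hence are the successive blocks of [y]. *)
Lemma image_parse (A : eqType) (sigma : seq A -> seq A) Y x y s P
    (B : int -> int) :
  word_morphism sigma -> [::] \notin map sigma Y ->
  parse Y x s -> image_at sigma x y P -> (forall p, block_at s P p (B p)) ->
  parse (map sigma Y) y (fun p => (sigma (s (B p)).1, `|p - P (B p)|%N)).
Proof.
move=> sigmaP nY sP xyP BP p /=; have [sb /andP[le_p lt_p]] := BP p.
have sE := block_image sigmaP sP xyP sb (leqnn _); rewrite take_size in sE.
have lt_s : (`|p - P (B p)| < size (sigma (s (B p)).1))%N.
  by move: lt_p; rewrite sE; lia.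
have [Yb _ _ _] := sP (B p); split=> //; first exact: map_f.
- have [_] := image_at_factor (B p) (size (s (B p)).1) sigmaP xyP.
  rewrite (block_factor sP sb) // take_size => {1}<-.
  by rewrite nth_mkseq //; congr y; lia.
- rewrite /next_ok /=; have := block_at_next sigmaP nY sP xyP (BP p).
  rewrite /= sE.
  case: ifP => lt_p1.
    move/(block_at_uniq sP xyP (BP (p + 1)))=> ->; rewrite ifT; last by lia.
    by apply/eqP; congr (_, _); lia.
  case=> eP /(block_at_uniq sP xyP (BP (p + 1)))=> ->; rewrite ifF; last by lia.
  by rewrite sE; lia.
Qed.

(** Both points give the same factorization of [y] over [map sigma Y], hence the
    same blocks of [Y] in [x] and [x'], up to the indices [B p] and [B' p] of
    their first letters in the two points. The differences of these indices
    along [p] are determined by the blocks ([BS]); they coincide at [p = 0]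
    because the representations are centered ([EB0]), so they coincide
    everywhere. *)
Lemma representation_unique (A : eqType) (sigma : seq A -> seq A) Y y
    x x' s s' k k' :
  word_morphism sigma -> elementary (map sigma Y) -> aperiodic y ->
  parse Y x s -> representation sigma y x k -> centered sigma x k ->
  parse Y x' s' -> representation sigma y x' k' -> centered sigma x' k' ->
  x =1 x' /\ k = k'.
Proof.
move=> hsigma elY aper sP xk ck sP' xk' ck'.
have nX := elementary_nil elY.
have injY : {in Y &, injective sigma}.
  move=> v w Yv Yw eq_vw; have := elementary_uniq elY.
  rewrite -(nth_index v Yv) -(nth_index v Yw) in eq_vw *.
  move/(uniqP [::]) => inj; congr nth.
  apply: inj; rewrite ?inE ?size_map ?index_mem //.
  by rewrite !(nth_map v) ?index_mem.
have [P xyP P0] := representation_image hsigma xk.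
have [P' xyP' P0'] := representation_image hsigma xk'.
have [B BP] := functional_choice _ (fun p => block_at_ex p sP xyP).
have [B' BP'] := functional_choice _ (fun p => block_at_ex p sP' xyP').
have SS' := parse_unique elY aper (image_parse hsigma nX sP xyP BP)
  (image_parse hsigma nX sP' xyP' BP').
have sE p : s (B p) = s' (B' p).
  have [Ys _ _ _] := sP (B p); have [Ys' _ _ _] := sP' (B' p).
  have [sb _] := BP p; have [sb' _] := BP' p.
  case: (SS' p) => /(injY _ _ Ys Ys').
  by case: (s _) (s' _) sb sb' => [w j] [w' j'] /= -> -> ->.
have PE p : P (B p) = P' (B' p).
  by case: (SS' p) => _; have [_ ?] := BP p; have [_ ?] := BP' p; lia.
have PjE p j : (j <= size (s (B p)).1)%N -> P (B p + j%:Z) = P' (B' p + j%:Z).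
  move=> le_j; have [sb _] := BP p; have [sb' _] := BP' p.
  rewrite (block_image hsigma sP xyP sb le_j) PE.
  by rewrite (block_image hsigma sP' xyP' sb') -sE.
have BS p : B (p + 1) - B p = B' (p + 1) - B' p.
  have := block_at_next hsigma nX sP xyP (BP p).
  have := block_at_next hsigma nX sP' xyP' (BP' p); rewrite /= -sE -PjE //.
  case: ifP => _.
    move=> /(block_at_uniq sP' xyP' (BP' (p + 1))) ->.
    by move=> /(block_at_uniq sP xyP (BP (p + 1))) ->; rewrite !subrr.
  move=> [_ /(block_at_uniq sP' xyP' (BP' (p + 1))) ->].
  by move=> [_ /(block_at_uniq sP xyP (BP (p + 1))) ->]; lia.
have [P1 _ _] := xyP; have [P1' _ _] := xyP'.
have {}ck : P 0 <= 0 < P (0 + 1)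
  by case/andP: ck => k0 lt_k; rewrite P1 P0 oppr_le0 k0 addrC subr_gt0.
have {}ck' : P' 0 <= 0 < P' (0 + 1)
  by case/andP: ck' => k0 lt_k; rewrite P1' P0' oppr_le0 k0 addrC subr_gt0.
have B0 := block_at_uniq sP xyP (BP 0) (block_at_index sP xyP ck).
have B0' := block_at_uniq sP' xyP' (BP' 0) (block_at_index sP' xyP' ck').
have sv : (s (B 0)).1 = (s 0).1 by rewrite B0 (block_start _ sP).
have sv' : (s (B 0)).1 = (s' 0).1 by rewrite sE B0' (block_start _ sP').
have [_ lt_s _ _] := sP 0; have [_ lt_s' _ _] := sP' 0.
have le_P : P' (B' 0 + (s 0).2%:Z) <= 0.
  by rewrite -PjE ?sv 1?ltnW // B0 addrNK; case/andP: ck.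
have le_P' : P (B 0 + (s' 0).2%:Z) <= 0.
  by rewrite PjE ?sv' 1?ltnW // B0' addrNK; case/andP: ck'.
(* If, say, [B 0 < B' 0], then the position in [y] of the letter [x 0], which is
   nonpositive, is that of a letter of [x'] of positive index. *)
have EB0 : B 0 = B' 0.
  have [lt_B|lt_B|//] := ltgtP (B 0) (B' 0).
    have lt1 : 0 + 1 <= B' 0 + (s 0).2%:Z by move: lt_B; rewrite B0; lia.
    have := le_trans (image_at_le xyP' lt1) le_P.
    by rewrite leNgt; case/andP: ck' => _ ->.
  have lt1 : 0 + 1 <= B 0 + (s' 0).2%:Z by move: lt_B; rewrite B0'; lia.
  have := le_trans (image_at_le xyP lt1) le_P'.
  by rewrite leNgt; case/andP: ck => _ ->.
have EB p : B p = B' p.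
  elim/int_rec: p => [|p IH|p IH] //.
    have -> : p.+1%:Z = p%:Z + 1 by lia.
    by apply: (addIr (- B p)); rewrite BS IH.
  have := BS (- p.+1%:Z); have -> : - p.+1%:Z + 1 = - p%:Z by lia.
  by rewrite IH => /addrI/oppr_inj.
split=> [i|]; last first.
  have := @PjE 0 (s 0).2; rewrite sv => /(_ (ltnW lt_s)).
  by rewrite -EB0 B0 addrNK P0 P0' => /oppr_inj.
have sb := block_start i sP; set b := i - (s i).2%:Z in sb.
have [|Bb _] := block_at_start (b := b) hsigma nX sP xyP; first by rewrite sb.
have {}Bb : B (P b) = b.
  apply: (block_at_uniq sP xyP (BP _)).
  by apply: (block_at_start hsigma nX sP xyP); rewrite sb.
have sb' : s' b = ((s i).1, 0%N) by have := sE (P b); rewrite -EB Bb sb.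
have [_ lt_i <- _] := sP i; have [_ _ <- _] := sP' i.
have := @parse_inside _ _ _ _ b (s i).2 sP'; rewrite sb' add0n subrK.
by move=> /(_ lt_i) -> /=; apply: set_nth_default.
Qed.

Theorem theorem1 (A : finType) (sigma : seq A -> seq A)
  (hsigma : word_morphism sigma) :
  recognizable_aperiodic sigma (shift_of sigma).
Proof.
have [n [Y [starY elY]]] := least_factorization hsigma.
have nY : [::] \notin Y.
  by apply: contra (elementary_nil elY) => /(map_f sigma); case: hsigma => ->.
have parseY z : shift_of sigma z -> exists s, parse Y z s.
  by move=> zX; apply: factors_parse => // i m; apply: shift_factor_star zX.
move=> y aper x x' k k' /parseY[s sP] xk ck /parseY[s' sP'] xk' ck'.
exact: representation_unique hsigma elY aper sP xk ck sP' xk' ck'.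
Qed.
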